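(* Let $p \in (1,\infty)$ and let $K \subset \mathbb{R}^{m\times n}$ be a compact $C^1$-submanifold with boundary satisfying $L^p$ quantitative rigidity. Then there exist constants $\rho = \rho(K,p) > 0$ and $C = C(K,p) > 0$ such that the following holds. If $\Phi:\mathbb{R}^{m\times n} \to \mathbb{R}^{m\times n}$ is bi-Lipschitz with $\operatorname{Lip}(\Phi - \mathrm{id}) \le \rho$, then $\tilde K := \Phi(K)$ satisfies $L^p$ quantitative rigidity with $C_{QR}(\tilde K,p) \le C$.
   Context: $Q := (0,1)^n$. ''Submanifold with boundary'' means an embedded submanifold whose boundary may be empty. $\mathbb{R}^{m\times n}$ carries the Euclidean (Frobenius) norm, $\operatorname{dist}_H(F) := \inf_{G\in H}|F-G|$, $(Du)_Q$ is the average of $Du$ over $Q$, and $\operatorname{Lip}$ denotes the Lipschitz constant. All $L^p$ norms are over $Q$. A closed (nonempty) set $H \subset \mathbb{R}^{m\times n}$ satisfies $L^p$ quantitative rigidity if there exists $C>0$ such that $$\|Du-(Du)_Q\|_{L^p} \le C \|\operatorname{dist}_H(Du)\|_{L^p} \quad \text{for all } u \in W^{1,p}(Q;\mathbb{R}^m).$$ $C_{QR}(H,p)$ denotes the optimal (smallest) constant in this estimate, i.e. the supremum of $\|Du-(Du)_Q\|_{L^p} / \|\operatorname{dist}_H(Du)\|_{L^p}$ over all $u\in W^{1,p}(Q;\mathbb{R}^m)$ with $\|\operatorname{dist}_H(Du)\|_{L^p}>0$; it equals $\infty$ if no finite constant works. *)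

(* Defs.v *)
From HB Require Import structures.
From mathcomp Require Import all_boot all_order all_algebra.
From mathcomp Require Import all_classical all_reals all_analysis.

Set Implicit Arguments.
Unset Strict Implicit.
Unset Printing Implicit Defensive.
Import Order.TTheory GRing.Theory Num.Theory.
Import numFieldNormedType.Exports.

Local Open Scope classical_set_scope.
Local Open Scope ring_scope.

(* Row vectors carry the product of the Borel sigma-algebras of R, that is,
   the sigma-algebra generated by the coordinates. *)
Definition rV_display : measure_display. Proof. exact: default_measure_display. Qed.

Section rV_measurable.
Context {R : realType} {n : nat}.

Let coord : 'I_n -> 'rV[R]_n -> measurableTypeR R := fun i x => x ord0 i.

Let rV_set0 : g_sigma_preimage coord set0.
Proof. exact: sigma_algebra0. Qed.

Let rV_setC A : g_sigma_preimage coord A -> g_sigma_preimage coord (~` A).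
Proof. exact: sigma_algebraC. Qed.

Let rV_bigcup (F : (set 'rV[R]_n)^nat) :
  (forall i, g_sigma_preimage coord (F i)) ->
  g_sigma_preimage coord (\bigcup_i (F i)).
Proof. exact: sigma_algebra_bigcup. Qed.

HB.instance Definition _ := @isMeasurable.Build rV_display 'rV[R]_n
  (g_sigma_preimage coord) rV_set0 rV_setC rV_bigcup.

Lemma measurable_coord_rV (i : 'I_n) :
  measurable_fun [set: 'rV[R]_n] (fun x => x ord0 i : measurableTypeR R).
Proof.
move=> _ Y mY; apply: sub_sigma_algebra.
rewrite -bigcup_seq /=; exists i; first by rewrite /= mem_index_enum.
by exists Y.
Qed.

Lemma measurable_fun_rV d (T : measurableType d) (f : T -> 'rV[R]_n) :
  (forall i, measurable_fun setT (fun t => f t ord0 i : measurableTypeR R)) ->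
  measurable_fun setT f.
Proof.
move=> mf; apply: (measurability (\big[setU/set0]_(i < n)
  preimage_set_system setT (coord i) measurable)) => //.
move=> _ [B + <-]; rewrite -bigcup_seq => -[i _ [Y mY <-]].
rewrite setTI -(setTI (f @^-1` _)) !setTI.
by have := mf i measurableT _ mY; rewrite !setTI.
Qed.

End rV_measurable.

Section lebesgue_rV.
Context {R : realType}.

Definition cons_rV n (z : measurableTypeR R * 'rV[R]_n) : 'rV[R]_n.+1 :=
  row_mx (const_mx z.1 : 'rV_1) z.2.

Definition uncons_rV n (v : 'rV[R]_n.+1) : measurableTypeR R * 'rV[R]_n :=
  (v ord0 ord0, rsubmx (v : 'rV_(1 + n))).

Lemma cons_rVK n : cancel (@cons_rV n) (@uncons_rV n).
Proof.
case=> a x; rewrite /uncons_rV /cons_rV row_mxKr; congr pair.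
have -> : (ord0 : 'I_(1 + n)) = lshift n ord0 by apply: val_inj.
by apply: etrans (row_mxEl _ _ _ _) _; rewrite mxE.
Qed.

Lemma measurable_cons_rV n : measurable_fun setT (@cons_rV n).
Proof.
apply: measurable_fun_rV => i.
case: (@split_ordP 1 n i) => j ->; rewrite /cons_rV.
- rewrite (_ : (fun _ => _) = fst); first exact: measurable_fst.
  by apply/funext => z; apply: etrans (row_mxEl _ _ _ _) _; rewrite mxE.
- rewrite (_ : (fun _ => _) = (fun x : 'rV[R]_n => x ord0 j) \o snd).
    by apply: measurableT_comp; [exact: measurable_coord_rV|exact: measurable_snd].
  by apply/funext => z; exact: row_mxEr.
Qed.

Lemma measurable_uncons_rV n : measurable_fun setT (@uncons_rV n).
Proof.
apply/measurable_fun_pairP; split; first exact: measurable_coord_rV.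
apply: measurable_fun_rV => i /=.
rewrite (_ : (fun _ => _) =
  fun v : 'rV[R]_n.+1 => v ord0 (rshift 1 i : 'I_n.+1)).
  exact: measurable_coord_rV.
by apply/funext => v; rewrite mxE.
Qed.

Section step.
Variables (n : nat) (mu : {sigma_finite_measure set 'rV[R]_n -> \bar R}).

Definition cons_measure : set 'rV[R]_n.+1 -> \bar R :=
  pushforward (@lebesgue_measure R \x mu)%E (@cons_rV n).


Let cons_measure0 : cons_measure set0 = 0%E.
Proof. by rewrite /cons_measure /pushforward preimage_set0 measure0. Qed.

Let cons_measure_ge0 A : (0 <= cons_measure A)%E.
Proof. exact: (measure_ge0 (@lebesgue_measure R \x mu)%E). Qed.

Let cons_measure_additive : semi_sigma_additive cons_measure.
Proof.
move=> F mF tF mUF; rewrite /cons_measure /pushforward preimage_bigcup.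
have mc A : measurable A -> measurable (@cons_rV n @^-1` A).
  by move=> mA; rewrite -[X in measurable X]setTI; exact: measurable_cons_rV.
apply: measure_semi_sigma_additive.
- by move=> k; exact: mc.
- apply/trivIsetP => /= i j _ _ ij; rewrite -preimage_setI.
  by move/trivIsetP : tF => /(_ _ _ _ _ ij) ->//; rewrite preimage_set0.
- by rewrite -preimage_bigcup; exact: mc.
Qed.

HB.instance Definition _ := isMeasure.Build _ _ _ cons_measure
  cons_measure0 cons_measure_ge0 cons_measure_additive.

Let cons_measure_sigma_finite : sigma_finite setT cons_measure.
Proof.
have /sigma_finiteP[F [FT ndF Ffin]] := sigma_finiteT (@lebesgue_measure R).
have /sigma_finiteP[G [GT ndG Gfin]] := sigma_finiteT mu.
exists (fun k => @uncons_rV n @^-1` (F k `*` G k)).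
  rewrite -preimage_bigcup [X in _ @^-1` X](_ : _ = setT) ?preimage_setT //.
  rewrite -setXTT FT GT predeqE => -[x y]; split.
    by move=> [k _ []/= ? ?]; split; exists k.
  move=> [/= [k _ Fx] [l _ Gy]]; exists (maxn k l) => //; split.
  - by move: x Fx; exact/subsetPset/ndF/leq_maxl.
  - by move: y Gy; exact/subsetPset/ndG/leq_maxr.
move=> k; have [mF Foo] := Ffin k; have [mG Goo] := Gfin k; split.
  rewrite -[X in measurable X]setTI.
  by apply: measurable_uncons_rV => //; exact: measurableX.
rewrite /cons_measure /pushforward -comp_preimage.
rewrite (_ : _ \o _ = id) ?preimage_id; last by apply/funext; exact: cons_rVK.
by rewrite product_measure1E// lte_mul_pinfty// ge0_fin_numE.
Qed.

HB.instance Definition _ := Measure_isSigmaFinite.Build _ _ _ cons_measure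
  cons_measure_sigma_finite.

End step.

Fixpoint lebesgue_rV (n : nat) : {sigma_finite_measure set 'rV[R]_n -> \bar R} :=
  if n is k.+1 then cons_measure (lebesgue_rV k) else \d_(0 : 'rV[R]_0).

End lebesgue_rV.

Section sobolev.
Context {R : realType}.

Definition unit_cube n : set 'rV[R]_n := [set x | forall i, 0 < x ord0 i < 1].

Lemma measurable_unit_cube n : measurable (@unit_cube n).
Proof.
rewrite (_ : @unit_cube n =
    \bigcap_(i in [set: 'I_n]) [set x | x ord0 i \in `]0%R, 1%R[]); last first.
  apply/seteqP; split=> x xQ i; first by rewrite /= in_itv /=; move=> _; exact: xQ.
  by have := xQ i Logic.I; rewrite /= in_itv.
apply: fin_bigcap_measurable => [|i _]; first exact: finite_finset.
have := @measurable_coord_rV R n i measurableT _ (measurable_itv `]0%R, 1%R[).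
by rewrite setTI.
Qed.

Lemma lebesgue_rV_unit_cube n : lebesgue_rV n (@unit_cube n) = 1%E.
Proof.
elim: n => [|n IH] /=.
  rewrite diracE mem_set //; by case.
rewrite /cons_measure /pushforward.
rewrite (_ : _ @^-1` _ = `]0%R, 1%R[%classic `*` @unit_cube n).
  rewrite product_measure1E //; last exact: measurable_unit_cube.
  rewrite IH mule1; have := lebesgue_measure_itv (`]0%R, 1%R[ : interval R).
  by rewrite /= lte_fin ltr01 -EFinD subr0.
apply/seteqP; split => -[a x] /=.
  move=> h; split => /=.
    rewrite in_itv /=; have := h (lshift n (ord0 : (ordinal 1))).
    rewrite (_ : fun_of_matrix (cons_rV _) _ _ = a) //.
    by apply: etrans (row_mxEl _ _ _ _) _; rewrite mxE.
  move=> i; have := h (rshift 1 i).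
  by rewrite (_ : fun_of_matrix (cons_rV _) _ _ = x ord0 i) //; apply: row_mxEr.
case=> /=; rewrite in_itv /= => ha hx i; case: (@split_ordP 1 n i) => j ->.
  rewrite (_ : fun_of_matrix (cons_rV _) _ _ = a) //.
    by apply: etrans (row_mxEl _ _ _ _) _; rewrite mxE.
by rewrite (_ : fun_of_matrix (cons_rV _) _ _ = x ord0 j) //; apply: row_mxEr.
Qed.

Definition cube_measure n : set 'rV[R]_n -> \bar R :=
  mrestr (lebesgue_rV n) (@measurable_unit_cube n).
HB.instance Definition _ n := Measure.on (@cube_measure n).

(* Smoothness: every iterated directional derivative is differentiable. *)
Definition smooth n (phi : 'rV[R]_n -> R) :=
  forall (vs : seq 'rV[R]_n) x,
    differentiable (foldr (fun v g => 'D_v g) phi vs) x.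

Definition test_function n (phi : 'rV[R]_n -> R) :=
  [/\ smooth phi,
      compact (closure [set x | phi x != 0]) &
      closure [set x | phi x != 0] `<=` @unit_cube n].

(* [sobolev p u Du]: u is in W^{1,p}(Q; R^m) with weak gradient Du, where
   (Du)_ij = d_j u_i.  The functions are Borel representatives of the
   almost-everywhere classes, and their values outside Q are irrelevant. *)
Definition sobolev m n (p : R) (u : 'rV[R]_n -> 'cV[R]_m)
    (Du : 'rV[R]_n -> 'M[R]_(m, n)) :=
  [/\ forall i, (fun x => u x i ord0) \in Lfun (@cube_measure n) p%:E,
      forall i j, (fun x => Du x i j) \in Lfun (@cube_measure n) p%:E &
      forall phi, test_function phi -> forall i j,
        \int[@cube_measure n]_x (u x i ord0 * 'D_(delta_mx ord0 j) phi x) =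
        - \int[@cube_measure n]_x (Du x i j * phi x)].

Definition cube_mean m n (F : 'rV[R]_n -> 'M[R]_(m, n)) : 'M[R]_(m, n) :=
  \matrix_(i, j) ((fine (cube_measure [set: 'rV[R]_n]))^-1 *
                  \int[@cube_measure n]_x F x i j).

End sobolev.

Section rigidity.
Context {R : realType} {m n : nat}.
Implicit Types (H : set 'M[R]_(m, n)) (A B F G : 'M[R]_(m, n)).

(* The library norm on matrices is the sup norm, not the Euclidean one. *)
Definition frob A : R := Num.sqrt (\sum_i \sum_j A i j ^+ 2).

Definition dist_set H F : R := inf [set frob (F - G) | G in H].

Definition osc_norm (p : R) (Du : 'rV[R]_n -> 'M[R]_(m, n)) : \bar R :=
  Lnorm (@cube_measure R n) p%:E (fun x => (frob (Du x - cube_mean Du))%:E).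

Definition dist_norm (p : R) H (Du : 'rV[R]_n -> 'M[R]_(m, n)) : \bar R :=
  Lnorm (@cube_measure R n) p%:E (fun x => (dist_set H (Du x))%:E).

Definition rigidity_estimate (p : R) H (C : R) :=
  forall u Du, sobolev p u Du -> (osc_norm p Du <= C%:E * dist_norm p H Du)%E.

Definition has_rigidity_constant (p : R) H :=
  exists2 C : R, 0 < C & rigidity_estimate p H C.

Definition quantitative_rigidity (p : R) H :=
  [/\ closed H, H !=set0 & has_rigidity_constant p H].

Definition CQR (p : R) H : \bar R :=
  if `[< has_rigidity_constant p H >] then
    ereal_sup [set r | exists u Du,
      [/\ sobolev p u Du, (0 < dist_norm p H Du)%E &
          r = (osc_norm p Du / dist_norm p H Du)%E]]
  else +oo%E.

Definition Lip (Phi : 'M[R]_(m, n) -> 'M[R]_(m, n)) : \bar R :=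
  ereal_sup [set r | exists A B,
    A != B /\ r = (frob (Phi A - Phi B) / frob (A - B))%:E].

Definition bilipschitz (Phi : 'M[R]_(m, n) -> 'M[R]_(m, n)) :=
  exists2 L : R, 0 < L & forall A B,
    L^-1 * frob (A - B) <= frob (Phi A - Phi B) <= L * frob (A - B).

End rigidity.

Section submanifold.
Context {R : realType}.

Definition C1_on (V W : normedModType R) (U : set V) (f : V -> W) :=
  forall x, U x ->
    differentiable f x /\ forall v, {for x, continuous (fun y => 'D_v f y)}.

(* R^d x {0} in R^N *)
Definition model_space N d : set 'rV[R]_N :=
  [set y | forall i : 'I_N, (d <= i)%N -> y ord0 i = 0].

(* {y in R^d | y_d >= 0} x {0} in R^N *)
Definition model_half_space N d : set 'rV[R]_N :=
  [set y | model_space d y /\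
           forall i : 'I_N, i.+1 = d -> 0 <= y ord0 i].

(* K is, near x, the preimage of a model under a C^1 diffeomorphism psi from a
   neighbourhood U of x onto an open set W, with inverse chi. *)
Definition C1_chart m n d (K : set 'M[R]_(m, n)) (x : 'M[R]_(m, n)) :=
  exists (U : set 'M[R]_(m, n)) (W : set 'rV[R]_(m * n))
         (psi : 'M[R]_(m, n) -> 'rV[R]_(m * n))
         (chi : 'rV[R]_(m * n) -> 'M[R]_(m, n)),
  [/\ [/\ open U, U x & open W],
      [/\ psi @` U = W, chi @` W = U & {in U, cancel psi chi}],
      C1_on U psi, C1_on W chi &
      psi @` (K `&` U) = W `&` model_space d \/
      psi @` (K `&` U) = W `&` model_half_space d].

Definition C1_submanifold m n (K : set 'M[R]_(m, n)) :=
  exists2 d, (d <= m * n)%N & forall x, K x -> C1_chart d K x.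

End submanifold.

(* Main.v *)
From HB Require Import structures.
Require Import Defs.
From mathcomp Require Import all_boot all_order all_algebra.
From mathcomp Require Import all_classical all_reals all_analysis.
From mathcomp Require Import measurable_realfun ring lra.
Import Order.TTheory GRing.Theory Num.Theory.
Import numFieldNormedType.Exports.
Local Open Scope classical_set_scope.
Local Open Scope ring_scope.

(** Recentring: given [u], let [P = Phi P'] be the point of [Phi K] nearest to
    the mean [B] of [Du], and apply the rigidity of [K] to the function
    [v x = u x - (P - P') x].  For [G'] in [K] and [G = Phi G'] one has
    [Dv - G' = (Du - G) + (Phi G' - G') - (Phi P' - P')], so that the
    perturbation costs only [rho |G' - P'|], which is controlled by
    [dist (Du, Phi K) + |Du - B|].  Hence the oscillation of [Du] is at most
    [C ((1 + 4 rho) |dist| + 4 rho |Du - B|)], and the last term is absorbed for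
    [rho] small.  That linear functions are Sobolev on the cube follows from
    Fubini and the one-dimensional fundamental theorem of calculus. *)

(** * Integrals of partial derivatives over the cube *)

(** As [g] vanishes off the open unit interval, the integral over the line is one over [[0, 1]],
    where the fundamental theorem of calculus evaluates it as [G 1 - G 0]. *)
Lemma integral_derivative_eq0 (R : realType) (g G : R -> R) :
  continuous g -> (forall t : R, is_derive t 1 G (g t)) ->
  (forall t, ~ (0 < t < 1) -> g t = 0) -> G 0 = 0 -> G 1 = 0 ->
  (\int[@lebesgue_measure R]_t (g t)%:E = 0)%E.
Proof.
move=> cg dG g0 G0 G1.
have cG : continuous G.
  by move=> t; apply: differentiable_continuous; apply/derivable1_diffP; case: (dG t).
transitivity (\int[@lebesgue_measure R]_(t in `[0%R, 1%R]) (g t)%:E)%E.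
  rewrite [RHS]integral_mkcond; apply: eq_integral => t _.
  rewrite patchE; case: ifPn => //; rewrite notin_setE /= in_itv /= => tn.
  by rewrite g0 // => /andP[t0 t1]; apply: tn; rewrite !ltW.
rewrite (@continuous_FTC2 _ g G) ?ltr01 //.
- by rewrite G0 G1 sube0.
- exact: continuous_subspaceT.
- split; first by move=> t _; case: (dG t).
    exact/cvg_at_right_filter/cG.
  exact/cvg_at_left_filter/cG.
- by move=> t _; rewrite derive1E; case: (dG t).
Qed.

Lemma integrable_bounded_support d (T : measurableType d) (R : realType)
    (mu : {measure set T -> \bar R}) (f : T -> R) (A : set T) (M : R) :
  measurable A -> (mu A < +oo)%E -> measurable_fun setT f ->
  (forall x, `|f x| <= M) -> (forall x, ~ A x -> f x = 0) ->
  mu.-integrable setT (EFin \o f).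
Proof.
move=> mA Aoo mf fM f0.
have -> : EFin \o f = (EFin \o f) \_ A.
  apply/funext => x; rewrite patchE; case: ifPn => //.
  by rewrite notin_setE /= => /f0 ->.
apply/(integrable_mkcond _ mA); apply: measurable_bounded_integrable => //.
  exact: measurable_funTS.
exists M; split; first exact: num_real.
by move=> N MN x _ /=; apply: (le_trans (fM x)); exact: ltW.
Qed.

Lemma cons_rV_head (R : realType) n (z : R * 'rV[R]_n) :
  cons_rV z ord0 ord0 = z.1.
Proof.
have -> : (ord0 : 'I_n.+1) = lshift n (ord0 : 'I_1) by apply: val_inj.
by apply: etrans (row_mxEl _ _ _ _) _; rewrite mxE.
Qed.

Lemma cons_rV_tail (R : realType) n (z : R * 'rV[R]_n) (i : 'I_n) :
  cons_rV z ord0 (lift ord0 i) = z.2 ord0 i.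
Proof.
have -> : lift ord0 i = rshift 1 i :> 'I_n.+1 by apply: val_inj.
exact: row_mxEr.
Qed.

(** Together with [cons_rV_delta_lift], this carries coordinate lines through the splitting into
    head and tail, so that hypotheses stated along lines restrict to Fubini slices. *)
Lemma cons_rV_delta0 (R : realType) n (a t : R) (y : 'rV[R]_n) :
  cons_rV (a + t, y) = cons_rV (a, y) + t *: delta_mx ord0 ord0.
Proof.
apply/rowP => i; rewrite [RHS]mxE [X in _ = _ + X]mxE [X in _ = _ + _ * X]mxE.
have [j ->|->] := unliftP ord0 i; last by rewrite !cons_rV_head eqxx mulr1.
by rewrite !cons_rV_tail /= mulr0 addr0.
Qed.

Lemma cons_rV_delta_lift (R : realType) n (a t : R) (y : 'rV[R]_n) (j : 'I_n) :
  cons_rV (a, y + t *: delta_mx ord0 j) =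
  cons_rV (a, y) + t *: delta_mx ord0 (lift ord0 j).
Proof.
apply/rowP => i; rewrite [RHS]mxE [X in _ = _ + X]mxE [X in _ = _ + _ * X]mxE.
have [k ->|->] := unliftP ord0 i; last first.
  by rewrite !cons_rV_head /= mulr0 addr0.
by rewrite !cons_rV_tail /= !mxE (inj_eq lift_inj).
Qed.

Lemma unit_cube_cons (R : realType) n (z : R * 'rV[R]_n) :
  unit_cube (cons_rV z) <-> 0 < z.1 < 1 /\ unit_cube z.2.
Proof.
split=> [Qz|[z1 z2] i].
  by split=> [|i]; [have := Qz ord0; rewrite cons_rV_head|
    have := Qz (lift ord0 i); rewrite cons_rV_tail].
have [j ->|->] := unliftP ord0 i; first by rewrite cons_rV_tail.
by rewrite cons_rV_head.
Qed.

(** Induction on the dimension, splitting off the first coordinate by Fubini; boundedness and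
    support in the cube make [f] integrable. The inner integral is always taken over the factor
    containing direction [j], and it already vanishes. *)
Lemma integral_partial_derivative_eq0 (R : realType) n (j : 'I_n) (M : R)
    (f F : 'rV[R]_n -> R) :
  measurable_fun setT f -> (forall x, `|f x| <= M) ->
  (forall x, ~ unit_cube x -> f x = 0) -> (forall x, ~ unit_cube x -> F x = 0) ->
  (forall x, continuous (fun t : R => f (x + t *: delta_mx ord0 j))) ->
  (forall x (t : R), is_derive t 1 (fun s : R => F (x + s *: delta_mx ord0 j))
                       (f (x + t *: delta_mx ord0 j))) ->
  (\int[lebesgue_rV n]_x (f x)%:E = 0)%E.
Proof.
elim: n j f F => [[]//|n IH] j f F mf fM f0 F0 cf dF.
have mc : measurable_fun setT (fun z : measurableTypeR R * 'rV[R]_n => cons_rV z).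
  exact: measurable_cons_rV.
have mfc : measurable_fun setT (f \o @cons_rV R n) by exact: measurableT_comp.
have ifc : (lebesgue_measure \x lebesgue_rV n)%E.-integrable setT
    (EFin \o (f \o @cons_rV R n)).
  apply: (@integrable_bounded_support _ _ _ _ _
    (@cons_rV R n @^-1` (@unit_cube R n.+1)) M) => //.
  - rewrite -[X in measurable X]setTI; apply: mc => //.
    exact: measurable_unit_cube.
  - rewrite [ltLHS](_ : _ = lebesgue_rV n.+1 (@unit_cube R n.+1)) //.
    by rewrite lebesgue_rV_unit_cube ltry.
  - by move=> x; exact: fM.
  - by move=> x; exact: f0.
rewrite [LHS]/= /cons_measure.
rewrite (integral_pushforward mc) //; last exact/measurable_EFinP.
have [k jk|j0] := unliftP ord0 j.
  (* Direction [j] lies in the tail: the inner integral runs over the tail, and the induction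
     hypothesis applies to each slice with fixed head [a]. *)
  rewrite preimage_setT -integral12_prod_meas1 //.
  apply: integral0_eq => a _; rewrite /fubini_F /=.
  apply: (IH k (fun y => f (cons_rV (a, y))) (fun y => F (cons_rV (a, y)))).
  - exact: (measurableT_comp mfc).
  - by move=> y; exact: fM.
  - by move=> y yQ; apply: f0 => /unit_cube_cons[_ /yQ].
  - by move=> y yQ; apply: F0 => /unit_cube_cons[_ /yQ].
  - move=> y; rewrite (_ : (fun t => _) =
        fun t => f (cons_rV (a, y) + t *: delta_mx ord0 j)); first exact: cf.
    by apply/funext => t; rewrite jk cons_rV_delta_lift.
  - move=> y t; have := dF (cons_rV (a, y)) t; rewrite jk -cons_rV_delta_lift.
    by congr is_derive; apply/funext => s; rewrite cons_rV_delta_lift.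
(* Direction [j] is the head: the inner integral runs over the head, and the one-dimensional case
   applies to each line with fixed tail [y]. *)
rewrite preimage_setT -integral21_prod_meas1 //.
apply: integral0_eq => y _; rewrite /fubini_G /=.
have cE (t : R) : cons_rV (t, y) = cons_rV (0, y) + t *: delta_mx ord0 j.
  by rewrite j0 -cons_rV_delta0 add0r.
apply: (@integral_derivative_eq0 _ _ (fun t => F (cons_rV (t, y)))).
- rewrite (_ : (fun t => _) =
      fun t => f (cons_rV (0, y) + t *: delta_mx ord0 j)); first exact: cf.
  by apply/funext => t; rewrite -cE.
- move=> t; have := dF (cons_rV (0, y)) t; rewrite -cE.
  by congr is_derive; apply/funext => s; rewrite -cE.
- by move=> t t01; apply: f0 => /unit_cube_cons[/t01].
- by apply: F0 => /unit_cube_cons[]; rewrite /= ltxx.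
- by apply: F0 => /unit_cube_cons[]; rewrite /= ltxx andbF.
Qed.

(** Both sides reduce to integrals over the cube, and the two measures agree on its measurable
    subsets. *)
Lemma integral_cube_measureE (R : realType) n (f : 'rV[R]_n -> R) :
  (forall x, ~ unit_cube x -> f x = 0) ->
  (\int[@cube_measure R n]_x (f x)%:E = \int[lebesgue_rV n]_x (f x)%:E)%E.
Proof.
move=> f0.
have supp (mu : {measure set 'rV[R]_n -> \bar R}) :
    (\int[mu]_x (f x)%:E = \int[mu]_(x in @unit_cube R n) (f x)%:E)%E.
  rewrite [RHS]integral_mkcond; apply: eq_integral => x _.
  by rewrite patchE; case: ifPn => //; rewrite notin_setE /= => /f0 ->.
rewrite supp [RHS]supp; apply: eq_measure_integral => A mA AQ.
by rewrite /= /cube_measure /mrestr setIidl.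
Qed.

(** * Measurability and the Frobenius norm *)

(** An open set is a countable union of boxes with rational centres and radii [1/(k+1)]; each box is
    a finite intersection of preimages under coordinates. *)
Lemma open_measurable_rV (R : realType) n (U : set 'rV[R]_n) :
  open U -> measurable U.
Proof.
move=> oU.
pose box (c : 'rV[rat]_n * nat) : set 'rV[R]_n :=
  [set x | forall i, `|ratr (c.1 ord0 i) - x ord0 i| < c.2.+1%:R^-1].
have mbox c : measurable (box c).
  rewrite (_ : box c = \bigcap_(i in [set: 'I_n])
      ((fun x : 'rV[R]_n => x ord0 i) @^-1` ball (ratr (c.1 ord0 i) : R) c.2.+1%:R^-1)).
    apply: fin_bigcap_measurable => [|i _]; first exact: finite_finset.
    rewrite -[X in measurable X]setTI; apply: measurable_coord_rV => //.
    exact: measurable_ball.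
  by apply/seteqP; split=> x xc i; [move=> _; exact: xc|exact: (xc i)].
(* Boxes that leave [U] are replaced by the empty set, so that the union runs over the whole
   countable index type. *)
pose V c := if `[< box c `<=` U >] then box c else set0.
suff -> : U = \bigcup_c V c.
  apply: countable_bigcupT_measurable => [|c]; first exact: countableP.
  by rewrite /V; case: ifPn.
apply/seteqP; split=> [x Ux|x [c _]]; last first.
  by rewrite /V; case: ifPn => // /asboolP; exact.
have /nbhs_ballP[e /= e0 xeU] := open_nbhs_nbhs (conj oU Ux).
(* Half of [e], because a point of the box reaches [x] through the rational centre, which costs the
   radius twice. *)
have [k] : exists k, 0 + k.+1%:R^-1 < e / 2 by apply: ltr_add_invr; rewrite divr_gt0.
rewrite add0r => ke.
have /choice[q xq] : forall i : 'I_n, exists q : rat, `|ratr q - x ord0 i| < k.+1%:R^-1.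
  move=> i; have [|q] := @rat_in_itvoo R (x ord0 i) (x ord0 i + k.+1%:R^-1).
    by rewrite ltrDl invr_gt0.
  rewrite in_itv /= => /andP[xq qx]; exists q; rewrite ger0_norm ?subr_ge0 1?ltW //.
  by rewrite ltrBlDl.
exists (\row_i q i, k) => //; rewrite /V asboolT; first by move=> i; rewrite /= mxE.
move=> y yc; apply: xeU; split=> // i j; rewrite (ord1 i).
have := yc j; have := xq j; rewrite /= mxE => xqj qyj.
rewrite /ball /= (le_lt_trans (ler_distD (ratr (q j)) _ _)) //.
rewrite [ltRHS]splitr ltrD //; first by rewrite distrC; exact: lt_trans xqj ke.
exact: lt_trans qyj ke.
Qed.

Lemma continuous_measurable_rV (R : realType) n (f : 'rV[R]_n -> R) :
  continuous f -> measurable_fun setT f.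
Proof.
move=> cf; apply: (measurability _ (RGenOInfty.measurableE R)).
move=> /= _ [_ [a ->]] <-; apply: measurableI => //.
by apply: open_measurable_rV; exact: open_comp.
Qed.

(** The matrix is flattened by [mxvec] to a row vector, where measurability can be checked on
    coordinates; [vec_mx] is continuous because it only rearranges entries. *)
Lemma measurable_mx_comp d (T : measurableType d) (R : realType) m n
    (g : 'M[R]_(m, n) -> R) (F : T -> 'M[R]_(m, n)) :
  continuous g -> (forall i j, measurable_fun setT (fun x => F x i j)) ->
  measurable_fun setT (g \o F).
Proof.
move=> cg mF; rewrite (_ : g \o F = (g \o vec_mx) \o (mxvec \o F)); last first.
  by apply/funext => x /=; rewrite mxvecK.
apply: measurableT_comp.
  apply: continuous_measurable_rV => v; apply: continuous_comp; last exact: cg.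
  move=> U /nbhs_ballP[e /= e0 eU]; apply/nbhs_ballP; exists e => // w [_ vw].
  by apply: eU; split=> // i j; rewrite !mxE; exact: vw.
apply: measurable_fun_rV => k; case/mxvec_indexP: k => i j /=.
by have := mF i j; congr measurable_fun; apply/funext => x; rewrite mxvecE.
Qed.

(** Lagrange's identity: the double sum of the squares [(a i * b j - a j * b i) ^+ 2] is twice the
    difference of the two sides. *)
Lemma sumr_cauchy_schwarz (R : realFieldType) (I : finType) (a b : I -> R) :
  (\sum_i a i * b i) ^+ 2 <= (\sum_i a i ^+ 2) * (\sum_i b i ^+ 2).
Proof.
have : 0 <= \sum_i \sum_j (a i * b j - a j * b i) ^+ 2.
  by do 2 apply: sumr_ge0 => ? _; exact: sqr_ge0.
rewrite (_ : \sum_i _ = ((\sum_i a i ^+ 2) * (\sum_i b i ^+ 2) -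
  (\sum_i a i * b i) ^+ 2) *+ 2); first by rewrite pmulrn_lge0 // subr_ge0.
transitivity (\sum_i \sum_j (a i ^+ 2 * b j ^+ 2) + \sum_i \sum_j (b i ^+ 2 * a j ^+ 2)
  - (\sum_i \sum_j (a i * b i) * (a j * b j)) *+ 2).
  rewrite -sumrMnl -sumrN -!big_split /=; apply: eq_bigr => i _.
  rewrite -sumrMnl -sumrN -!big_split /=; apply: eq_bigr => j _; ring.
under eq_bigr do rewrite -mulr_sumr.
under [X in _ + X - _]eq_bigr do rewrite -mulr_sumr.
under [X in _ - X *+ 2]eq_bigr do rewrite -mulr_sumr.
rewrite -!mulr_suml; ring.
Qed.

(** * The Frobenius norm and the distance to a set *)

Section frobenius.
Context {R : realType} {m n : nat}.
Implicit Types (A B F G : 'M[R]_(m, n)) (H : set 'M[R]_(m, n)).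

Lemma frob_ge0 A : 0 <= frob A.
Proof. exact: sqrtr_ge0. Qed.

Lemma frob_sum_ge0 A : 0 <= \sum_i \sum_j A i j ^+ 2.
Proof. by do 2 apply: sumr_ge0 => ? _; exact: sqr_ge0. Qed.

Lemma frob0 : frob (0 : 'M[R]_(m, n)) = 0.
Proof.
rewrite /frob big1 ?sqrtr0 // => i _; rewrite big1 // => j _.
by rewrite mxE expr0n.
Qed.

Lemma frobN A : frob (- A) = frob A.
Proof.
by congr Num.sqrt; do 2 apply: eq_bigr => ? _; rewrite mxE sqrrN.
Qed.

Lemma frob_distC A B : frob (A - B) = frob (B - A).
Proof. by rewrite -frobN opprB. Qed.

Lemma ler_frobD A B : frob (A + B) <= frob A + frob B.
Proof.
rewrite -ler_sqr ?nnegrE ?addr_ge0 ?frob_ge0 // sqrrD /frob !sqr_sqrtr ?frob_sum_ge0 //.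
rewrite -sqrtrM ?frob_sum_ge0 // !pair_bigA /=.
set S := \sum_(p : 'I_m * 'I_n) A p.1 p.2 * B p.1 p.2.
rewrite (_ : \sum_p _ = \sum_(p : 'I_m * 'I_n) A p.1 p.2 ^+ 2 + S *+ 2
    + \sum_(p : 'I_m * 'I_n) B p.1 p.2 ^+ 2).
  rewrite lerD2r lerD2l lerMn2r /= (le_trans (ler_norm _)) //.
  by rewrite -sqrtr_sqr ler_wsqrtr //; exact: sumr_cauchy_schwarz.
by rewrite -sumrMnl -!big_split; apply: eq_bigr => p _ /=; rewrite mxE; ring.
Qed.

Lemma ler_frob_distD G A B : frob (A - B) <= frob (A - G) + frob (G - B).
Proof. by rewrite (le_trans _ (ler_frobD _ _)) // addrA subrK. Qed.

Lemma ler_entry_frob A i j : `|A i j| <= frob A.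
Proof.
rewrite -sqrtr_sqr ler_wsqrtr // (bigD1 i) //= (bigD1 j) //= -addrA lerDl.
by apply: addr_ge0; rewrite ?sumr_ge0 // => *; rewrite ?sumr_ge0 // => *; exact: sqr_ge0.
Qed.

(** Each [|A i j|] is at most the total sum [S], so the sum of squares is at most [S ^+ 2]. This
    lets integrability of the entries pass to the norm. *)
Lemma ler_frob_sum A : frob A <= \sum_i \sum_j `|A i j|.
Proof.
have S0 : 0 <= \sum_i \sum_j `|A i j| by do 2 apply: sumr_ge0 => ? _.
rewrite -(ger0_norm S0) -sqrtr_sqr ler_wsqrtr // !pair_bigA /=.
rewrite [leRHS]expr2 big_distrl /=; apply: ler_sum => p _.
by rewrite -real_normK ?num_real // expr2 ler_wpM2l // (bigD1 p) //= lerDl sumr_ge0.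
Qed.

Lemma frob_continuous : continuous (@frob R m n).
Proof.
move=> A; apply: (@continuous_comp _ _ _
  (fun A : 'M[R]_(m, n) => \sum_i \sum_j A i j ^+ 2)
  Num.sqrt); last exact: sqrt_continuous.
have add2 : continuous (fun x : R * R => x.1 + x.2).
  by move=> x; apply: cvgD; [exact: cvg_fst|exact: cvg_snd].
apply: (continuous_big (op := +%R) (x0 := 0)) => // i _.
apply: (continuous_big (op := +%R) (x0 := 0)) => // j _ B.
exact: (continuous_comp (@coord_continuous R m n i j B) (@exprn_continuous R 2 _)).
Qed.

Lemma frob_dist_continuous G : continuous (fun F => frob (F - G)).
Proof.
move=> F; apply: (@continuous_comp _ _ _ (fun F => F - G) (@frob R m n));
  last exact: frob_continuous.
by apply: (@continuousB _ _ _ id (fun=> G)); [|exact: cst_continuous].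
Qed.

(** Compares with the sup norm that defines the topology of matrices: it yields definiteness of
    [frob] and turns Frobenius estimates into continuity. *)
Lemma ler_norm_frob A : `|A| <= frob A.
Proof.
rewrite /Num.norm /= mx_normrE; apply/bigmax_leP; split; first exact: frob_ge0.
by move=> [i j] _; exact: ler_entry_frob.
Qed.

Lemma dist_set_ge0 H F : 0 <= dist_set H F.
Proof.
(* The infimum of the empty set has the default value 0. *)
have [->|/set0P[G HG]] := eqVneq H set0; first by rewrite /dist_set image_set0 inf0.
by apply: lb_le_inf; [exists (frob (F - G)), G|move=> _ [G' _ <-]; exact: frob_ge0].
Qed.

Lemma dist_set_le H F G : H G -> dist_set H F <= frob (F - G).
Proof.
move=> HG; apply: ge_inf; last by exists G.
by exists 0 => _ [G' _ <-]; exact: frob_ge0.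
Qed.

Lemma le_dist_set H F (c : R) :
  H !=set0 -> (forall G, H G -> c <= frob (F - G)) -> c <= dist_set H F.
Proof.
move=> [G HG] cH; apply: lb_le_inf; first by exists (frob (F - G)), G.
by move=> _ [G' HG' <-]; exact: cH.
Qed.

Lemma dist_set_lip H F G : H !=set0 -> dist_set H F <= dist_set H G + frob (F - G).
Proof.
move=> H0; rewrite -lerBlDr; apply: le_dist_set => // A HA.
rewrite lerBlDr (le_trans (dist_set_le _ F _ HA)) // [leRHS]addrC.
exact: ler_frob_distD.
Qed.

(** The Lipschitz bound is in the Frobenius norm while neighbourhoods come from the sup norm;
    continuity of the Frobenius distance to [F] provides the passage. *)
Lemma dist_set_continuous H : H !=set0 -> continuous (dist_set H).
Proof.
move=> H0 F U /nbhs_ballP[e /= e0 eU].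
have := frob_dist_continuous F F _ (nbhsx_ballx (frob (F - F)) e e0).
rewrite subrr frob0; apply: (@filterS _ (nbhs F)) => G; rewrite /ball /= sub0r normrN.
rewrite ger0_norm ?frob_ge0 // => GF; apply: eU.
rewrite /ball /= (le_lt_trans _ GF) // ler_norml.
have := dist_set_lip H F G H0; have := dist_set_lip H G F H0.
rewrite (frob_distC F); lra.
Qed.

End frobenius.

(** * Lp functions on the cube *)

Section Lp.
Context d (T : measurableType d) (R : realType).
Variables (mu : {measure set T -> \bar R}) (p : R).
Hypothesis p1 : 1 <= p.

Lemma Lfun_measurable (f : T -> R) : f \in Lfun mu p%:E -> measurable_fun setT f.
Proof. by rewrite inE => /andP[]; rewrite inE. Qed.

Lemma Lnorm_lty (f : T -> R) : f \in Lfun mu p%:E -> ('N[mu]_p%:E [EFin \o f] < +oo)%E.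
Proof. by rewrite inE => /andP[_]; rewrite inE. Qed.

Lemma le_Lnorm (f g : T -> R) :
  measurable_fun setT f -> measurable_fun setT g -> (forall x, `|f x| <= g x) ->
  ('N[mu]_p%:E [EFin \o f] <= 'N[mu]_p%:E [EFin \o g])%E.
Proof.
move=> mf mg fg; have p0 : 0 <= p by rewrite (le_trans ler01).
have mpow (h : T -> R) : measurable_fun setT h ->
    measurable_fun setT (fun x => `|(h x)%:E| `^ p)%E.
  move=> mh; apply/measurable_EFinP.
  apply: (measurableT_comp (measurable_powR _)) => //.
  exact: measurableT_comp.
rewrite unlock; apply: gt0_ler_poweR; rewrite ?invr_ge0 //.
- by rewrite in_itv /= leey integral_ge0 // => x _; exact: poweR_ge0.
- by rewrite in_itv /= leey integral_ge0 // => x _; exact: poweR_ge0.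
apply: ge0_le_integral => //.
- by move=> x _; exact: poweR_ge0.
- exact: mpow.
- exact: mpow.
- move=> x _; apply: gt0_ler_poweR => //=;
    rewrite ?in_itv /= ?leey ?lee_fin ?normr_ge0 //.
  exact: le_trans (fg x) (ler_norm _).
Qed.

Lemma Lfun_dominated (f g : T -> R) :
  measurable_fun setT f -> (forall x, `|f x| <= g x) ->
  g \in Lfun mu p%:E -> f \in Lfun mu p%:E.
Proof.
move=> mf fg gL; rewrite inE; apply/andP; split; rewrite inE //=.
rewrite /finite_norm (le_lt_trans _ (Lnorm_lty _ gL)) //.
by apply: le_Lnorm => //; exact: Lfun_measurable.
Qed.

Let p1E : (1 <= p%:E)%E. Proof. by rewrite lee_fin. Qed.

Lemma LfunB (f g : T -> R) : f \in Lfun mu p%:E -> g \in Lfun mu p%:E ->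
  (fun x => f x - g x) \in Lfun mu p%:E.
Proof.
move=> fL gL; rewrite (_ : (fun x => _) = f + (- g)) //.
by apply: (Lfun_addr_closed _ p1E).2 => //; exact: Lfun_oppr_closed.
Qed.

Lemma Lfun_sum (I : Type) (r : seq I) (F : I -> T -> R) :
  (forall i, F i \in Lfun mu p%:E) ->
  (fun x => \sum_(i <- r) F i x) \in Lfun mu p%:E.
Proof.
move=> FL; elim: r => [|i r IH].
  rewrite (_ : (fun _ => _) = 0); first exact: (Lfun_addr_closed mu p1E).1.
  by apply/funext => x; rewrite big_nil.
rewrite (_ : (fun _ => _) = F i + (fun x => \sum_(j <- r) F j x)).
  exact: (Lfun_addr_closed mu p1E).2.
by apply/funext => x; rewrite big_cons.
Qed.

Lemma LnormZ_Lfun (f : T -> R) (a : R) : f \in Lfun mu p%:E ->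
  ('N[mu]_p%:E [EFin \o (a \*: f)] = `|a|%:E * 'N[mu]_p%:E [EFin \o f])%E.
Proof. by move=> fL; rewrite -(LnormZ (Lfun_Sub p1E fL)). Qed.

Lemma Lfun_normr (f : T -> R) :
  f \in Lfun mu p%:E -> (fun x => `|f x|) \in Lfun mu p%:E.
Proof.
move=> fL; rewrite inE; apply/andP; split; rewrite inE /=.
  by apply: measurableT_comp => //; exact: Lfun_measurable.
rewrite /finite_norm (_ : _ \o _ = (abse \o (EFin \o f))%E) //.
by rewrite Lnorm_abse; exact: Lnorm_lty.
Qed.

Lemma Lfun_frob m n (F : T -> 'M[R]_(m, n)) :
  (forall i j, (fun x => F x i j) \in Lfun mu p%:E) ->
  (fun x => frob (F x)) \in Lfun mu p%:E.
Proof.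
move=> FL; apply: (@Lfun_dominated _ (fun x => \sum_i \sum_j `|F x i j|)).
- apply: (measurable_mx_comp _ _ _ _ _ (@frob R m n) F) => [|i j].
    exact: frob_continuous.
  exact: Lfun_measurable.
- by move=> x; rewrite ger0_norm ?frob_ge0 //; exact: ler_frob_sum.
- by do 2 apply: Lfun_sum => ?; exact: Lfun_normr.
Qed.

End Lp.

(** * The cube as a probability space *)

Lemma cube_measureT (R : realType) n : @cube_measure R n setT = 1%E.
Proof.
by rewrite -(lebesgue_rV_unit_cube n) /cube_measure /mrestr setTI.
Qed.

Lemma cube_measure_fin (R : realType) n : fin_num_fun (@cube_measure R n).
Proof.
move=> A mA; rewrite ge0_fin_numE // (@le_lt_trans _ _ (@cube_measure R n setT)) //.
  by apply: le_measure; rewrite ?inE.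
by rewrite cube_measureT ltry.
Qed.

HB.instance Definition _ (R : realType) n :=
  Measure_isFinite.Build _ _ _ (@cube_measure R n) (@cube_measure_fin R n).

Section Lp_cube.
Context (R : realType) (n : nat) (p : R).
Hypothesis p1 : 1 <= p.
Let mu := @cube_measure R n.

Lemma Lfun_cube_bounded (f : 'rV[R]_n -> R) (M : R) :
  measurable_fun setT f -> (forall x, `|f x| <= M) -> f \in Lfun mu p%:E.
Proof.
move=> mf fM; apply: (Lfun_dominated _ _ _ _ _ p1 _ (cst M)) => //.
exact: Lfun_cst.
Qed.

(** On a space of finite measure the Lebesgue spaces decrease with the exponent, and [1 <= p]. *)
Lemma Lfun_cube_integrable (f : 'rV[R]_n -> R) :
  f \in Lfun mu p%:E -> mu.-integrable setT (EFin \o f).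
Proof.
move=> fL; apply/Lfun1_integrable; apply: Lfun_subset fL; rewrite ?lee_fin //.
exact: fin_num_measure.
Qed.

Lemma integrable_cube_mul_bounded (f h : 'rV[R]_n -> R) (M : R) :
  f \in Lfun mu p%:E -> measurable_fun setT h -> (forall x, `|h x| <= M) ->
  mu.-integrable setT (EFin \o (fun x => f x * h x)).
Proof.
move=> fL mh hM; apply: (@integrableMl _ _ _ mu _ measurableT (EFin \o f) h) => //.
  exact: Lfun_cube_integrable.
exists M; split; first exact: num_real.
by move=> N MN x _ /=; apply: (le_trans (hM x)); exact: ltW.
Qed.

Lemma cube_mean_sub m (F : 'rV[R]_n -> 'M[R]_(m, n)) (A : 'M[R]_(m, n)) :
  (forall i j, (fun x => F x i j) \in Lfun mu p%:E) ->
  cube_mean (fun x => F x - A) = cube_mean F - A.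
Proof.
move=> FL; apply/matrixP => i j; rewrite !mxE cube_measureT invr1 !mul1r.
under eq_Rintegral do rewrite mxE [X in _ + X]mxE.
rewrite RintegralB //; last 2 first.
- exact: Lfun_cube_integrable.
- exact: finite_measure_integrable_cst.
(* The cube has mass 1, so a constant is its own mean. *)
rewrite Rintegral_cst //; congr (_ - _); rewrite -[RHS]mulr1.
by congr (_ * _); rewrite -[RHS]/(fine 1%E); congr fine; exact: cube_measureT.
Qed.

End Lp_cube.

(** * Linear functions are Sobolev *)

Lemma bounded_of_compact_support (R : realType) n (g : 'rV[R]_n -> R) (S : set 'rV[R]_n) :
  continuous g -> compact S -> (forall x, ~ S x -> g x = 0) ->
  exists M, forall x, `|g x| <= M.
Proof.
move=> cg cS g0.
have /ex_strict_bound_gt0[M M0 gM] : bounded_set (g @` S).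
  by apply/compact_bounded/continuous_compact => //; exact: continuous_subspaceT.
exists M => x; have [Sx|Sx] := pselect (S x).
  by apply/ltW/gM; exists x.
by rewrite g0 // normr0 ltW.
Qed.

(** The difference quotients of the restriction to the line and of the directional derivative
    coincide. This supplies the line derivatives demanded by [integral_partial_derivative_eq0]. *)
Lemma is_derive_line (R : realType) n (f : 'rV[R]_n -> R) (x v : 'rV[R]_n) (t : R) :
  differentiable f (x + t *: v) ->
  is_derive t 1 (fun s : R => f (x + s *: v)) ('D_v f (x + t *: v)).
Proof.
move=> df.
have E : (fun h : R => h^-1 *: (((fun s : R => f (x + s *: v)) \o shift t) (h *: 1) -
      f (x + t *: v))) =
    (fun h : R => h^-1 *: ((f \o shift (x + t *: v)) (h *: v) - f (x + t *: v))).
  apply/funext => h /=; rewrite (_ : h *: 1 = h); last exact: mulr1.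
  by rewrite scalerDl addrCA.
have dv : derivable f (x + t *: v) v by exact: diff_derivable.
by apply: DeriveDef; rewrite /derivable /derive E.
Qed.

(** * Regularity, support and bounds of test functions *)

Section test_function.
Context (R : realType) (n : nat) (phi : 'rV[R]_n -> R).
Hypothesis tphi : test_function phi.

Lemma test_function_continuous : continuous phi.
Proof.
(* In [smooth], the empty list of directions gives differentiability of [phi] itself; a one-element
   list gives that of a directional derivative. *)
by move=> x; apply: differentiable_continuous; case: tphi => /(_ [::] x).
Qed.

Lemma test_function_differentiable x : differentiable phi x.
Proof. by case: tphi => /(_ [::] x). Qed.

Lemma test_function_derive_continuous v : continuous ('D_v phi).
Proof.
by move=> x; apply: differentiable_continuous; case: tphi => /(_ [:: v] x).
Qed.

Let S := closure [set x | phi x != 0].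

Lemma test_function_vanish x : ~ S x -> phi x = 0.
Proof.
by move=> Sx; apply/eqP/negPn/negP => px; apply: Sx; exact: subset_closure.
Qed.

(** The complement of the support is open, so [phi] is identically zero near [x]. *)
Lemma test_function_derive_vanish v x : ~ S x -> 'D_v phi x = 0.
Proof.
move=> Sx; rewrite (@near_eq_derive _ _ _ phi (cst 0)) ?derive_cst //.
have oS : open (~` S) by apply: closed_openC; exact: closed_closure.
have : nbhs x (~` S) by apply: open_nbhs_nbhs.
by apply: (@filterS _ (nbhs x)) => y /test_function_vanish.
Qed.

Lemma test_function_support x : ~ unit_cube x -> ~ S x.
Proof. by case: tphi => _ _ SQ xQ /SQ. Qed.

Lemma test_function_bounded : exists M, forall x, `|phi x| <= M.
Proof.
apply: (bounded_of_compact_support _ _ _ S); first exact: test_function_continuous.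
  by case: tphi.
exact: test_function_vanish.
Qed.

Lemma test_function_derive_bounded v : exists M, forall x, `|'D_v phi x| <= M.
Proof.
apply: (bounded_of_compact_support _ _ _ S); first exact: test_function_derive_continuous.
  by case: tphi.
exact: test_function_derive_vanish.
Qed.

End test_function.

(** * The truncated linear function and its weak gradient *)

Section cube_linear.
Context {R : realType} {m n : nat}.
Implicit Types (A : 'M[R]_(m, n)) (x : 'rV[R]_n).

(* Truncated outside the cube so that it is bounded everywhere. *)
Definition cube_linear A x : 'cV[R]_m :=
  if `[< unit_cube x >] then A *m x^T else 0.

Lemma mulmx_trE A x i : (A *m x^T) i ord0 = \sum_k A i k * x ord0 k.
Proof. by rewrite mxE; apply: eq_bigr => k _; rewrite mxE. Qed.

Lemma measurable_mulmx_tr A i : measurable_fun setT (fun x => (A *m x^T) i ord0).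
Proof.
rewrite (_ : (fun _ => _) = fun x => \sum_k A i k * x ord0 k); last first.
  by apply/funext => x; exact: mulmx_trE.
apply: measurable_sum => k; apply: measurable_funM; first exact: measurable_cst.
exact: measurable_coord_rV.
Qed.

Lemma measurable_cube_linear A i : measurable_fun setT (fun x => cube_linear A x i ord0).
Proof.
rewrite (_ : (fun _ => _) =
    fun x => (A *m x^T) i ord0 * (\1_(@unit_cube R n) x : R)); last first.
  apply/funext => x; rewrite indicE /cube_linear.
  have [Qx|Qx] := pselect (unit_cube x); first by rewrite asboolT // mem_set // mulr1.
  by rewrite asboolF // memNset // mulr0 mxE.
apply: measurable_funM; first exact: measurable_mulmx_tr.
by apply: measurable_indic; exact: measurable_unit_cube.
Qed.

Lemma cube_linear_bounded A i x : `|cube_linear A x i ord0| <= \sum_k `|A i k|.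
Proof.
rewrite /cube_linear; case: ifPn => [/asboolP Qx|_]; last first.
  by rewrite mxE normr0 sumr_ge0.
rewrite mulmx_trE (le_trans (ler_norm_sum _ _ _)) //; apply: ler_sum => k _.
rewrite normrM ler_piMr // ger0_norm; first by case/andP: (Qx k) => _ /ltW.
by case/andP: (Qx k) => /ltW.
Qed.

(** Removes the truncation against a factor supported in the cube, leaving a genuine linear function
    that can be differentiated along lines. *)
Lemma cube_linear_mul A i x (c : R) : (~ unit_cube x -> c = 0) ->
  cube_linear A x i ord0 * c = (A *m x^T) i ord0 * c.
Proof.
rewrite /cube_linear; case: ifPn => // /asboolPn Qx /(_ Qx) ->.
by rewrite !mulr0.
Qed.

(** Integration by parts, showing that [A] is the weak gradient. The sum of the two integrands is
    the derivative in direction [j] of the product of the [i]-th component of [A x] with [phi x];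
    this product vanishes outside the cube, so the sum integrates to zero. *)
Lemma integral_cube_linear_derive A (phi : 'rV[R]_n -> R) i j :
  test_function phi ->
  \int[@cube_measure R n]_x
    (cube_linear A x i ord0 * 'D_(delta_mx ord0 j) phi x) =
  - \int[@cube_measure R n]_x (A i j * phi x).
Proof.
move=> tphi; set v := delta_mx ord0 j.
have [M1 phiM] := test_function_bounded _ _ _ tphi.
have [M2 dphiM] := test_function_derive_bounded _ _ _ tphi v.
have phi0 x : ~ unit_cube x -> phi x = 0.
  by move=> /(test_function_support _ _ _ tphi)/test_function_vanish.
have dphi0 x : ~ unit_cube x -> 'D_v phi x = 0.
  by move=> /(test_function_support _ _ _ tphi)/test_function_derive_vanish.
have mphi : measurable_fun setT phi.
  by apply: continuous_measurable_rV; exact: test_function_continuous.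
have mdphi : measurable_fun setT ('D_v phi).
  by apply: continuous_measurable_rV; exact: test_function_derive_continuous.
have i1 : (@cube_measure R n).-integrable setT
    (EFin \o (fun x => cube_linear A x i ord0 * 'D_v phi x)).
  apply: (integrable_cube_mul_bounded _ _ 1 _ _ _ M2) => //.
  apply: (Lfun_cube_bounded _ _ _ _ _ (\sum_k `|A i k|)) => //.
    exact: measurable_cube_linear.
  exact: cube_linear_bounded.
have i2 : (@cube_measure R n).-integrable setT (EFin \o (fun x => A i j * phi x)).
  apply: (integrable_cube_mul_bounded _ _ 1 _ (cst (A i j)) _ M1) => //.
  exact: (Lfun_cube_bounded _ _ _ _ _ `|A i j|).
apply/eqP; rewrite -addr_eq0 -RintegralD //; apply/eqP.
pose f x := cube_linear A x i ord0 * 'D_v phi x + A i j * phi x.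
rewrite -[LHS]/(fine (\int[@cube_measure R n]_x (f x)%:E)).
have f0 x : ~ unit_cube x -> f x = 0.
  by move=> Qx; rewrite /f phi0 // dphi0 // !mulr0 addr0.
have fE x : f x = (A *m x^T) i ord0 * 'D_v phi x + A i j * phi x.
  by rewrite /f cube_linear_mul //; exact: dphi0.
rewrite integral_cube_measureE //.
have line (x : 'rV[R]_n) (t : R) :
    (A *m (x + t *: v)^T) i ord0 = (A *m x^T) i ord0 + t * A i j.
  rewrite linearD linearZ /= mulmxDr -scalemxAr mxE [X in _ + X]mxE.
  congr (_ + _ * _); rewrite mulmx_trE (bigD1 j) //= big1 ?addr0.
    by rewrite mxE !eqxx mulr1.
  by move=> k /negbTE kj; rewrite mxE kj andbF mulr0.
have cline (x : 'rV[R]_n) : continuous (fun t : R => x + t *: v).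
  move=> t; apply: cvgD; first exact: cvg_cst.
  by apply: cvgZr_tmp; exact: cvg_id.
have -> : (\int[lebesgue_rV n]_x (f x)%:E = 0)%E; last by [].
apply: (@integral_partial_derivative_eq0 _ _ j
  ((\sum_k `|A i k|) * M2 + `|A i j| * M1) f
  (fun x => (A *m x^T) i ord0 * phi x)) => //.
- apply: measurable_funD; apply: measurable_funM => //.
  exact: measurable_cube_linear.
- move=> x; rewrite (le_trans (ler_normD _ _)) // !normrM.
  by rewrite lerD // ler_pM //; exact: cube_linear_bounded.
- by move=> x /phi0 ->; rewrite mulr0.
- move=> x; rewrite (_ : (fun t => _) = fun t : R =>
      ((A *m x^T) i ord0 + t * A i j) * 'D_v phi (x + t *: v) +
      A i j * phi (x + t *: v)); last first.
    by apply/funext => t; rewrite fE line.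
  move=> t; apply: cvgD; apply: cvgM.
  + by apply: cvgD; [exact: cvg_cst|apply: cvgM; [exact: cvg_id|exact: cvg_cst]].
  + exact: (@continuous_comp _ _ _ (fun t : R => x + t *: v) ('D_v phi) t (cline x t)
      (test_function_derive_continuous _ _ _ tphi _ _)).
  + exact: cvg_cst.
  + exact: (@continuous_comp _ _ _ (fun t : R => x + t *: v) phi t (cline x t)
      (test_function_continuous _ _ _ tphi _)).
- move=> x t; rewrite fE.
  rewrite (_ : (fun s : R => _) = (fun s : R => (A *m x^T) i ord0 + s * A i j) *
      (fun s : R => phi (x + s *: v))); last first.
    by apply/funext => s; rewrite line.
  have dl : is_derive t 1 (fun s : R => (A *m x^T) i ord0 + s * A i j) (A i j).
    rewrite (_ : (fun s => _) = cst ((A *m x^T) i ord0) + A i j *: (@id R)).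
      by apply: is_derive_eq; rewrite add0r [LHS]mulr1.
    by apply/funext => s; rewrite mulrC.
  have dp := is_derive_line _ _ phi x v t (test_function_differentiable _ _ _ tphi _).
  apply: (is_derive_eq (is_deriveM dl dp)).
  by rewrite -/v line; congr (_ + _); exact: mulrC.
Qed.
End cube_linear.

(** * Perturbation of rigid sets *)

Section perturbation.
Context {R : realType} {m n : nat}.
Implicit Types (A B F G : 'M[R]_(m, n)) (K H : set 'M[R]_(m, n)).

(** The recentring step: weak gradients are subtracted by linearity of the integral, each product
    being integrable because [phi] and its derivatives are bounded. *)
Lemma sobolev_sub_linear (p : R) u Du A : 1 <= p -> sobolev p u Du ->
  sobolev p (fun x => u x - cube_linear A x) (fun x => Du x - A).
Proof.
move=> p1 [uL DuL ibp].
have lL i : (fun x => cube_linear A x i ord0) \in Lfun (@cube_measure R n) p%:E.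
  apply: (Lfun_cube_bounded _ _ _ p1 _ (\sum_k `|A i k|)).
    exact: measurable_cube_linear.
  exact: cube_linear_bounded.
split.
- move=> i; rewrite (_ : (fun x => _) = fun x => u x i ord0 - cube_linear A x i ord0).
    exact: LfunB.
  by apply/funext => x; rewrite !mxE.
- move=> i j; rewrite (_ : (fun x => _) = fun x => Du x i j - A i j).
    by apply: LfunB => //; exact: Lfun_cst.
  by apply/funext => x; rewrite !mxE.
move=> phi tphi i j.
have [M1 phiM] := test_function_bounded _ _ _ tphi.
have [M2 dphiM] := test_function_derive_bounded _ _ _ tphi (delta_mx ord0 j).
have mphi : measurable_fun setT phi.
  by apply: continuous_measurable_rV; exact: test_function_continuous.
have mdphi : measurable_fun setT ('D_(delta_mx ord0 j) phi).
  by apply: continuous_measurable_rV; exact: test_function_derive_continuous.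
under eq_Rintegral do rewrite mxE [X in _ + X]mxE mulrBl.
under [in RHS]eq_Rintegral do rewrite mxE [X in _ + X]mxE mulrBl.
rewrite !RintegralB //; last 4 first.
- exact: (integrable_cube_mul_bounded _ _ p p1 _ _ M1).
- by apply: (integrable_cube_mul_bounded _ _ p p1 _ _ M1) => //; exact: Lfun_cst.
- exact: (integrable_cube_mul_bounded _ _ p p1 _ _ M2).
- exact: (integrable_cube_mul_bounded _ _ p p1 _ _ M2).
by rewrite ibp // integral_cube_linear_derive // opprB opprK addrC.
Qed.

(** The supremum in [Lip] ranges over distinct pairs only; for [A = B] both sides vanish. *)
Lemma Lip_frob_le (Psi : 'M[R]_(m, n) -> 'M[R]_(m, n)) (rho : R) A B :
  (Lip Psi <= rho%:E)%E -> frob (Psi A - Psi B) <= rho * frob (A - B).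
Proof.
move=> LPsi; have [->|AB] := eqVneq A B; first by rewrite !subrr frob0 mulr0.
have AB0 : 0 < frob (A - B).
  by rewrite (lt_le_trans _ (ler_norm_frob _)) // normr_gt0 subr_eq0.
rewrite -ler_pdivrMr // -lee_fin (le_trans _ LPsi) //.
by apply: ereal_sup_ubound; exists A, B.
Qed.

Lemma bilipschitz_continuous (Phi : 'M[R]_(m, n) -> 'M[R]_(m, n)) :
  bilipschitz Phi -> continuous Phi.
Proof.
move=> [L L0 LPhi] A U /nbhs_ballP[e /= e0 eU].
have eL : 0 < e / L by rewrite divr_gt0.
have := frob_dist_continuous A A _ (nbhsx_ballx (frob (A - A)) _ eL).
rewrite subrr frob0; apply: (@filterS _ (nbhs A)) => G; rewrite /ball /= sub0r normrN.
rewrite ger0_norm ?frob_ge0 // ltr_pdivlMr // mulrC => GA; apply: eU.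
rewrite mx_norm_ball /ball_ /= distrC (le_lt_trans (ler_norm_frob _)) //.
by rewrite (le_lt_trans _ GA) //; case/andP: (LPhi G A).
Qed.

(* Recentring at P turns the perturbation Phi - id into an error proportional
   to the distance from P, rather than to the diameter of K. *)
Lemma dist_set_recentred K (Phi : 'M[R]_(m, n) -> 'M[R]_(m, n)) (rho : R) B P F :
  0 <= rho -> rho <= 2^-1 ->
  (forall A A', frob ((Phi A - A) - (Phi A' - A')) <= rho * frob (A - A')) ->
  K P -> (forall G, K G -> frob (B - Phi P) <= frob (B - Phi G)) ->
  dist_set K (F - (Phi P - P)) <=
  (1 + 4 * rho) * dist_set (Phi @` K) F + 4 * rho * frob (F - B).
Proof.
move=> rho0 rho2 PhiL KP Pmin.
have rho4 : 0 < 1 + 4 * rho by lra.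
(* The distance to the image of [K] is isolated, so that the bound need only be tested against each
   point [Phi G] with [G] in [K]. *)
rewrite -lerBlDr -ler_pdivrMl // mulrC; apply: le_dist_set; first by exists (Phi P), P.
move=> _ [G KG <-]; rewrite ler_pdivrMr // lerBlDr mulrC.
have h1 := dist_set_le K (F - (Phi P - P)) G KG.
(* The matrix on the left is [(F - Phi G) + ((Phi G - G) - (Phi P - P))]. *)
have h2 : frob (F - (Phi P - P) - G) <= frob (F - Phi G) + rho * frob (G - P).
  rewrite (le_trans _ (lerD (lexx _) (PhiL G P))) //.
  rewrite (le_trans _ (ler_frobD _ _)) // le_eqVlt; apply/orP; left; apply/eqP.
  by congr frob; apply/matrixP => i j; rewrite !mxE; ring.
(* Here [G - P] is [(Phi G - Phi P) - ((Phi G - G) - (Phi P - P))]. *)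
have h3 : frob (G - P) <= frob (Phi G - Phi P) + rho * frob (G - P).
  rewrite (le_trans _ (lerD (lexx _) (PhiL G P))) // -[X in _ <= _ + X]frobN.
  rewrite (le_trans _ (ler_frobD _ _)) // le_eqVlt; apply/orP; left; apply/eqP.
  by congr frob; apply/matrixP => i j; rewrite !mxE; ring.
have h4 : frob (Phi G - Phi P) <= frob (F - Phi G) + frob (F - B) + frob (B - Phi P).
  rewrite (le_trans (ler_frob_distD F _ _)) // (frob_distC (Phi G)) -addrA lerD2l //.
  exact: ler_frob_distD.
have h5 : frob (B - Phi G) <= frob (F - B) + frob (F - Phi G).
  by rewrite (le_trans (ler_frob_distD F _ _)) // (frob_distC B).
have h6 := Pmin G KG.
have h7 : rho * frob (G - P) <= 2^-1 * frob (G - P) by rewrite ler_wpM2r ?frob_ge0.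
(* Minimality of [P] bounds [frob (Phi G - Phi P)] by twice the bracket; absorbing
   [rho * frob (G - P)] with [rho <= 1/2] doubles it again, whence the 4. *)
have h8 : frob (G - P) <= 4 * (frob (F - Phi G) + frob (F - B)) by lra.
have h9 := ler_wpM2l rho0 h8.
lra.
Qed.

(** The mean shifts by the same [A], so recentring leaves the left side of the rigidity estimate
    unchanged. *)
Lemma osc_norm_sub (p : R) (Du : 'rV[R]_n -> 'M[R]_(m, n)) A : 1 <= p ->
  (forall i j, (fun x => Du x i j) \in Lfun (@cube_measure R n) p%:E) ->
  osc_norm p (fun x => Du x - A) = osc_norm p Du.
Proof.
move=> p1 DuL; apply: eq_Lnorm => x; rewrite (cube_mean_sub _ _ _ p1) //.
by rewrite opprB addrA subrK.
Qed.

Lemma Lfun_osc (p : R) (Du : 'rV[R]_n -> 'M[R]_(m, n)) A : 1 <= p ->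
  (forall i j, (fun x => Du x i j) \in Lfun (@cube_measure R n) p%:E) ->
  (fun x => frob (Du x - A)) \in Lfun (@cube_measure R n) p%:E.
Proof.
move=> p1 DuL; apply: Lfun_frob => // i j.
rewrite (_ : (fun x => _) = fun x => Du x i j - A i j).
  by apply: LfunB => //; exact: Lfun_cst.
by apply/funext => x; rewrite !mxE.
Qed.

Lemma Lfun_dist_set (p : R) (Du : 'rV[R]_n -> 'M[R]_(m, n)) H : 1 <= p -> H !=set0 ->
  (forall i j, (fun x => Du x i j) \in Lfun (@cube_measure R n) p%:E) ->
  (fun x => dist_set H (Du x)) \in Lfun (@cube_measure R n) p%:E.
Proof.
move=> p1 [G HG] DuL; apply: Lfun_dominated (Lfun_osc _ _ G p1 DuL) => //.
- apply: (measurable_mx_comp _ _ _ _ _ (dist_set H) Du) => [|i j].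
    by apply: dist_set_continuous; exists G.
  exact: Lfun_measurable.
- by move=> x; rewrite ger0_norm ?dist_set_ge0 //; exact: dist_set_le.
Qed.

(** The smallness conditions fix the constant: [8 * C * rho <= 1] leaves at most half of the
    oscillation on the right, and [rho <= 1/2] gives [1 + 4 * rho <= 3], so absorption produces
    [2 * 3 * C]. *)
Lemma rigidity_perturbation (p C rho : R) K (Phi : 'M[R]_(m, n) -> 'M[R]_(m, n)) :
  1 <= p -> 0 < C -> 0 <= rho -> rho <= 2^-1 -> 8 * C * rho <= 1 ->
  compact K -> K !=set0 -> rigidity_estimate p K C -> continuous Phi ->
  (forall A A', frob ((Phi A - A) - (Phi A' - A')) <= rho * frob (A - A')) ->
  rigidity_estimate p (Phi @` K) (6 * C).
Proof.
move=> p1 C0 rho0 rho2 rhoC cK K0 Krig cPhi PhiL u Du sob.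
have [_ DuL _] := sob; set B := cube_mean Du.
have cBPhi : continuous (fun G => frob (Phi G - B)).
  move=> G; exact: (@continuous_comp _ _ _ Phi (fun F => frob (F - B)) G (cPhi G)
    (frob_dist_continuous B _)).
(* Minimizing over the compact [K] itself gives [P] in [K] whose image [Phi P] is nearest to the
   mean. *)
have [P KP Pmin] := compact_EVT_min K0 cK (continuous_subspaceT cBPhi).
have {}KP : K P by rewrite inE in KP.
have {}Pmin G : K G -> frob (B - Phi P) <= frob (B - Phi G).
  by move=> KG; rewrite !(frob_distC B); apply: Pmin; rewrite inE.
have PhiK0 : Phi @` K !=set0 by exists (Phi P), P.
pose a x := dist_set (Phi @` K) (Du x); pose b x := frob (Du x - B).
have aL : a \in Lfun (@cube_measure R n) p%:E by exact: Lfun_dist_set.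
have bL : b \in Lfun (@cube_measure R n) p%:E by exact: Lfun_osc.
have sobv := sobolev_sub_linear _ _ _ (Phi P - P) p1 sob.
have [_ DvL _] := sobv.
have := Krig _ _ sobv; rewrite osc_norm_sub // => est.
(* The pointwise bound of [dist_set_recentred], combined with Minkowski's inequality. *)
have dE : (dist_norm p K (fun x => (Du x - (Phi P - P))%R) <=
    (1 + 4 * rho)%R%:E * dist_norm p (Phi @` K) Du + (4 * rho)%R%:E * osc_norm p Du)%E.
  apply: (@le_trans _ _ ('N[@cube_measure R n]_p%:E
      [EFin \o (((1 + 4 * rho)%R \*: a) \+ ((4 * rho)%R \*: b))%R])%E).
    apply: le_Lnorm => //.
    - exact: (Lfun_measurable _ _ _ _ p _ (Lfun_dist_set _ _ _ p1 K0 DvL)).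
    - apply: measurable_funD; apply: measurable_funM => //.
        exact: Lfun_measurable aL.
      exact: Lfun_measurable bL.
    - move=> x; rewrite ger0_norm ?dist_set_ge0 //.
      exact: (dist_set_recentred _ _ _ B).
  apply: (le_trans (minkowski_EFin _ _ _ _)) => //.
  - by apply: measurable_funM => //; exact: Lfun_measurable aL.
  - by apply: measurable_funM => //; exact: Lfun_measurable bL.
  by rewrite !LnormZ_Lfun // !ger0_norm // ?mulr_ge0 //; lra.
(* Both norms are finite, so the estimate becomes one between reals and the oscillation can be
   subtracted from both sides. *)
have [d dD] : exists d : R, dist_norm p (Phi @` K) Du = d%:E /\ 0 <= d.
  exists (fine (dist_norm p (Phi @` K) Du)).
  by rewrite fineK ?fine_ge0 ?ge0_fin_numE ?Lnorm_ge0 //; exact: Lnorm_lty aL.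
have [s sS] : exists s : R, osc_norm p Du = s%:E /\ 0 <= s.
  exists (fine (osc_norm p Du)).
  by rewrite fineK ?fine_ge0 ?ge0_fin_numE ?Lnorm_ge0 //; exact: Lnorm_lty bL.
case: dD => dD d0; case: sS => sS s0.
have C0E : (0 <= C%:E)%E by rewrite lee_fin ltW.
move: (le_trans est (lee_wpmul2l C0E dE)).
rewrite dD sS -!EFinM !lee_fin => {}est.
have h1 : (8 * C * rho) * s <= s by rewrite ler_piMl.
have h2 : (C * d) * rho <= (C * d) * 2^-1.
  by rewrite ler_wpM2l // mulr_ge0 // ltW.
have : 0 <= C * d by rewrite mulr_ge0 // ltW.
have -> : 6 * C * d = 6 * (C * d) by ring.
have : C * ((1 + 4 * rho) * d + 4 * rho * s) =
  C * d + 4 * ((C * d) * rho) + 2^-1 * ((8 * C * rho) * s) by field.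
lra.
Qed.

Lemma CQR_le (p C : R) H : 0 < C -> rigidity_estimate p H C -> (CQR p H <= C%:E)%E.
Proof.
move=> C0 est; rewrite /CQR asboolT; last by exists C.
apply: ge_ereal_sup => _ [u [Du [sob d0 ->]]].
have := est _ _ sob; have := Lnorm_ge0 (@cube_measure R n) p%:E
  (fun x => (frob (Du x - cube_mean Du))%:E); rewrite -/(osc_norm p Du).
case: (dist_norm p H Du) d0 => [d| |] // d0 o0 od.
  by rewrite inver gt_eqF // lee_pdivrMr.
(* The remaining denominator is [+oo], whose inverse is 0, so the quotient is 0. *)
by rewrite invey mule0 lee_fin ltW.
Qed.

End perturbation.

Theorem theorem1p3 (R : realType) (m n : nat) (p : R) (K : set 'M[R]_(m, n))
    (m_gt0 : (0 < m)%N) (n_gt0 : (0 < n)%N) (p_gt1 : 1 < p)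
    (K_compact : compact K) (K_submfd : C1_submanifold K)
    (K_rigid : quantitative_rigidity p K) :
  exists rho C : R, [/\ 0 < rho, 0 < C &
    forall Phi : 'M[R]_(m, n) -> 'M[R]_(m, n),
      bilipschitz Phi ->
      (Lip (fun A => (Phi A - A)%R) <= rho%:E)%E ->
      quantitative_rigidity p (Phi @` K) /\ (CQR p (Phi @` K) <= C%:E)%E].
Proof.
have [_ K0 [C C0 Krig]] := K_rigid.
(* The two entries of the minimum are exactly the thresholds [rho <= 1/2] and [8 * C * rho <= 1] of
   [rigidity_perturbation]; they depend on [K] and [p] only through [C]. *)
have rho0 : 0 < Num.min 2^-1 (8 * C)^-1 by rewrite lt_min !invr_gt0 mulr_gt0 ?andbT.
exists (Num.min 2^-1 (8 * C)^-1), (6 * C); split => //; first by rewrite mulr_gt0.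
move=> Phi bPhi LPhi.
have cPhi := bilipschitz_continuous _ bPhi.
have est : rigidity_estimate p (Phi @` K) (6 * C).
  apply: (rigidity_perturbation _ _ (Num.min 2^-1 (8 * C)^-1)) => //.
  - exact: ltW.
  - exact: ltW.
  - by rewrite ge_min lexx.
  - by rewrite -ler_pdivlMl ?mulr_gt0 // mulr1 ge_min lexx orbT.
  - by move=> A A'; exact: (Lip_frob_le _ _ _ _ LPhi).
split; last by apply: CQR_le => //; rewrite mulr_gt0.
split; last by exists (6 * C) => //; rewrite mulr_gt0.
  apply: compact_closed; first exact: norm_hausdorff.
  by apply: continuous_compact => //; exact: continuous_subspaceT.
by case: K0 => G KG; exists (Phi G), G.
Qed.
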